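(* Let $I\subset\mathbb{R}$ be an interval, let $a,b\in I$ with $a<b$, and let $f:I\to\mathbb{R}$ be differentiable on the interior $I^{\circ}$ of $I$ and at every point of $[a,b]$ (one-sided derivatives being used at a point of $[a,b]$ that is an endpoint of $I$), with $f'\in L[a,b]$. Let $q>1$ and let $p$ satisfy $\frac1p+\frac1q=1$. Let $c>0$ and suppose that $|f'|^q$ is strongly convex on $[a,b]$ with modulus $c$ and that $|f'(u)|\le M$ for all $u\in[a,b]$. Let $x\in[a,b]$ be such that $M^q\ge \max\left\{\frac{c(x-a)^2}{6},\frac{c(b-x)^2}{6}\right\}$. Then $$\left| f(x)-\frac{1}{b-a}\int_a^b f(u)\,du\right| \le \frac{(x-a)^2}{b-a}\left(\frac{1}{p+1}\right)^{\frac1p}\left(M^q-\frac{c(x-a)^2}{6}\right)^{\frac1q}+\frac{(b-x)^2}{b-a}\left(\frac{1}{p+1}\right)^{\frac1p}\left(M^q-\frac{c(b-x)^2}{6}\right)^{\frac1q}.$$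
   Context: A function $h:J\to\mathbb{R}$ on an interval $J$ is called strongly convex with modulus $c>0$ if $h(tx+(1-t)y)\le t h(x)+(1-t)h(y)-ct(1-t)(x-y)^2$ for all $x,y\in J$ and $t\in(0,1)$. $L[a,b]$ denotes the space of Lebesgue integrable functions on $[a,b]$. *)

(* Defs.v *)
From mathcomp Require Import all_boot all_order all_algebra.
From mathcomp Require Import all_classical all_reals all_analysis.

Set Implicit Arguments.
Unset Strict Implicit.
Unset Printing Implicit Defensive.

Import Order.TTheory GRing.Theory Num.Theory.
Import numFieldNormedType.Exports.
Local Open Scope classical_set_scope.
Local Open Scope ring_scope.

(* A function defined on an interval J only is represented by a total function
   whose values outside J play no role. *)
Definition strongly_convex (R : realType) (J : interval R) (c : R)
    (h : R -> R) : Prop :=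
  0 < c /\
  forall x y t : R, x \in J -> y \in J -> 0 < t < 1 ->
    h (t * x + (1 - t) * y) <=
    t * h x + (1 - t) * h y - c * t * (1 - t) * (x - y) ^+ 2.

(* Derivative at x of a function defined on the interval I only: the difference
   quotient is restricted to points of I, so that this is the one-sided
   derivative at an endpoint of I and the usual one at an interior point
   (derivable_onE and derive1_onE below). *)
Definition diff_quotient (R : realType) (f : R -> R) (x y : R) : R :=
  (f y - f x) / (y - x).

Definition derivable_on (R : realType) (I : interval R) (f : R -> R)
    (x : R) : Prop :=
  cvg (diff_quotient f x y @[y --> within [set` I] x^']).

Definition derive1_on (R : realType) (I : interval R) (f : R -> R)
    (x : R) : R :=
  lim (diff_quotient f x y @[y --> within [set` I] x^']).

Lemma diff_quotient_interior (R : realType) (I : interval R) (f : R -> R)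
    (x : R) : ([set` I]° : set R) x ->
  diff_quotient f x y @[y --> within [set` I] x^'] =
  h^-1 *: (f (h + x) - f x) @[h --> 0^'].
Proof.
move=> Ix; apply/seteqP; split => A; rewrite /= /within /nbhs /=.
- move=> hA.
  have {}hA : \forall y \near x, y != x -> A (diff_quotient f x y).
    apply: filterS2 Ix hA => y Iy hA yx; exact: hA.
  move: hA => /(nbhs_ballP _ _)[e /= e0 hA].
  apply/nbhs_ballP; exists e => //= h.
  rewrite /ball /= sub0r normrN => he h0.
  have := hA (h + x); rewrite /ball /= opprD addrCA subrr addr0 normrN.
  rewrite /diff_quotient addrK -subr_eq0 addrK => /(_ he h0).
  by rewrite mulrC.
- move=> /(nbhs_ballP _ _)[e /= e0 hA].
  apply/nbhs_ballP; exists e => //= y xye yx _.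
  have := hA (y - x); rewrite /ball /= sub0r opprB subr_eq0 subrK => /(_ xye yx).
  by rewrite /diff_quotient mulrC.
Qed.

Lemma derivable_onE (R : realType) (I : interval R) (f : R -> R) (x : R) :
  ([set` I]° : set R) x -> derivable_on I f x <-> derivable f x 1.
Proof.
move=> Ix; rewrite /derivable_on diff_quotient_interior// /derivable.
have -> // : (fun h : R => h^-1 *: (f (h *: 1 + x) - f x)) =
             (fun h : R => h^-1 *: (f (h + x) - f x)).
by apply/funext => h; rewrite [h *: 1]mulr1.
Qed.

Lemma derive1_onE (R : realType) (I : interval R) (f : R -> R) (x : R) :
  ([set` I]° : set R) x -> derive1_on I f x = derive1 f x.
Proof. by move=> Ix; rewrite /derive1_on diff_quotient_interior. Qed.

(* Main.v *)
Require Import Defs.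
From mathcomp Require Import all_boot all_order all_algebra.
From mathcomp Require Import all_classical all_reals all_analysis.
From mathcomp Require Import ring lra.

(** For a fixed e the function G(u) = (u - e) f(u) - \int_a^u f has derivative
    (u - e) f'(u), and (b - a) f(x) - \int_a^b f is the increment of G over
    [a, x] for e = a plus its increment over [x, b] for e = b. Strong convexity
    gives |f'(s)|^q <= M^q - c (s - u)(v - s) on each half [u, v]; Young's
    inequality, normalized so that it integrates to the bound of the theorem,
    then dominates |G'| by an explicit H' with H elementary. Comparing
    increments of G and H by the mean value theorem replaces Holder's
    inequality and any integration of f'. *)

Set Implicit Arguments.
Unset Strict Implicit.
Unset Printing Implicit Defensive.

Import Order.TTheory GRing.Theory Num.Theory.
Import numFieldNormedType.Exports.
Local Open Scope classical_set_scope.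
Local Open Scope ring_scope.

(** Both [H - G] and [H + G] have nonnegative derivative, so by the mean value theorem neither
    decreases from u to v. This needs no integrability of the derivatives. *)
Lemma increment_le (R : realType) (G H dG dH : R -> R) (u v : R) :
  u <= v ->
  (forall s, s \in `]u, v[ -> is_derive s 1 G (dG s)) ->
  (forall s, s \in `]u, v[ -> is_derive s 1 H (dH s)) ->
  {within `[u, v], continuous G} -> {within `[u, v], continuous H} ->
  (forall s, s \in `]u, v[ -> `|dG s| <= dH s) ->
  `|G v - G u| <= H v - H u.
Proof.
rewrite le_eqVlt => /predU1P[->|uv] hG hH cG cH le.
  by rewrite !subrr normr0.
have E1 : exists2 s, s \in `]u, v[ &
    (H - G) v - (H - G) u = (dH s - dG s) * (v - u).
  apply: (@MVT R (H - G) (fun s => dH s - dG s)) => //.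
  - move=> s sI; have := hG _ sI; have := hH _ sI => ? ?; exact: is_deriveB.
  - exact: within_continuousB.
have E2 : exists2 s, s \in `]u, v[ &
    (H + G) v - (H + G) u = (dH s + dG s) * (v - u).
  apply: (@MVT R (H + G) (fun s => dH s + dG s)) => //.
  - move=> s sI; have := hG _ sI; have := hH _ sI => ? ?; exact: is_deriveD.
  - exact: within_continuousD.
move: E1 E2; rewrite !fctE => -[s sI es] [r rI er].
have := le _ sI; have := le _ rI; rewrite !ler_norml.
by move=> /andP[? ?] /andP[? ?]; apply/andP; split; nra.
Qed.

Lemma continuous_normr_powR (R : realType) (r : R) :
  0 < r -> continuous (fun t : R => `|t| `^ r).
Proof.
move=> r0 t; have [->|t0] := eqVneq t 0.
  rewrite /continuous_at/= normr0 powR0 ?gt_eqF//.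
  apply/cvgrPdist_lt => /= e e0.
  (* The radius e^(1/r) is chosen so that |y| < e^(1/r) gives |y|^r < e. *)
  have : \forall y \near (0 : R), `|y| < e `^ r^-1.
    by apply: nbhs0_lt; exact: powR_gt0.
  apply: filterS => y ye; rewrite sub0r normrN ger0_norm ?powR_ge0//.
  rewrite -[ltRHS]powRr1 ?(ltW e0)// -(mulVf (lt0r_neq0 r0)) powRrM.
  by apply: gt0_ltr_powR; rewrite ?nnegrE ?powR_ge0.
have c : {for `|t|, continuous (fun y : R => y `^ r)}.
  apply: differentiable_continuous; apply/derivable1_diffP.
  by apply: derivable_powR; rewrite in_itv/= andbT normr_gt0.
exact: (cvg_comp _ _ (@norm_continuous R R t) c).
Qed.

Lemma is_derive_normr_powR (R : realType) (r t : R) :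
  0 < t -> is_derive t 1 (fun y : R => `|y| `^ r) (r * t `^ (r - 1)).
Proof.
move=> t0; apply: (@near_eq_is_derive _ _ _ (fun y => y `^ r)) => //.
- by near=> y; rewrite gtr0_norm//; near: y; exact: lt_nbhsr.
- exact: is_derive1_powR.
Unshelve. all: by end_near. Qed.

(** Writing s = t z + (1 - t) y with t = (s - y) / (z - y) turns the modulus term t (1 - t) (z -
    y)^2 into (s - y)(z - s). *)
Lemma strongly_convex_le (R : realType) (J : interval R) (c m : R)
    (h : R -> R) (y z s : R) :
  strongly_convex J c h -> y \in J -> z \in J -> h y <= m -> h z <= m ->
  s \in `]y, z[ -> h s <= m - c * ((s - y) * (z - s)).
Proof.
move=> [c0 hc] yJ zJ hy hz; rewrite in_itv/= => /andP[ys sz].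
have zy : 0 < z - y by lra.
have zy0 : z - y != 0 by rewrite gt_eqF.
pose t := (s - y) / (z - y).
have t01 : 0 < t < 1.
  by rewrite /t divr_gt0 ?ltr_pdivrMr//; lra.
have := hc z y t zJ yJ t01.
have -> : t * z + (1 - t) * y = s by rewrite /t; field.
have -> : c * t * (1 - t) * (z - y) ^+ 2 = c * ((s - y) * (z - s)).
  by rewrite /t; field.
by move=> le; apply: (le_trans le); move/andP: t01 => [? ?]; nra.
Qed.

(* Young's inequality for ((p + 1)^(1/p) d / A) * (v / K^(1/q)): its first term
   has mean value 1/p over d in [0, A], its second 1/q if K is that of v^q. *)
Lemma normalized_young (R : realType) (p q A K d v : R) :
  0 < p -> 0 < q -> p^-1 + q^-1 = 1 -> 0 < A -> 0 < K -> 0 <= d -> 0 <= v ->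
  d * v <= A * (1 / (p + 1)) `^ (1 / p) * K `^ (1 / q) *
           ((p + 1) / p * (d / A) `^ p + v `^ q / (K * q)).
Proof.
move=> p0 q0 pq A0 K0 d0 v0; rewrite !div1r.
have p10 : 0 < p + 1 by lra.
have kq0 : 0 < K `^ q^-1 by exact: powR_gt0.
have kp0 : 0 < (p + 1) `^ p^-1 by exact: powR_gt0.
have dA0 : 0 <= d / A by rewrite divr_ge0// ltW.
have := @conjugate_powR R ((d / A) * (p + 1) `^ p^-1) (v / K `^ q^-1) p q.
have y0 := mulr_ge0 dA0 (ltW kp0); have z0 := divr_ge0 v0 (ltW kq0).
move=> /(_ y0 z0 p0 q0 pq).
have ki0 : 0 <= (K `^ q^-1)^-1 by rewrite invr_ge0 ltW.
have p11 : ((p + 1) `^ p^-1) `^ p = p + 1.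
  by rewrite -powRrM mulVf ?gt_eqF// powRr1 // ltW.
have kq : (K `^ q^-1)^-1 `^ q = K^-1.
  rewrite -(powR_inv1 (ltW kq0)) -!powRrM mulN1r mulrN mulVf ?gt_eqF//.
  by rewrite powR_inv1 // ltW.
have e1 : (p + 1)^-1 `^ p^-1 = ((p + 1) `^ p^-1)^-1.
  by rewrite -(powR_inv1 (ltW p10)) -powRrM mulN1r powRN.
rewrite (powRM _ dA0 (ltW kp0)) (powRM _ v0 ki0) p11 kq.
(* This factor undoes the normalization: it turns the product on the left back into d v. *)
rewrite -(@ler_pM2l _ (A * ((p + 1) `^ p^-1)^-1 * K `^ q^-1)); last first.
  by rewrite !mulr_gt0 ?invr_gt0.
move=> le; rewrite e1; apply: le_trans (le_trans _ le) _.
- by rewrite le_eqVlt; apply/orP; left; apply/eqP; field; rewrite !gt_eqF.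
- by rewrite le_eqVlt; apply/orP; left; apply/eqP; field; rewrite !gt_eqF.
Qed.

(** For y != u in I, f y = f u + [diff_quotient f u y] * (y - u), where the quotient converges and y
    - u tends to 0. The punctured limit suffices, since y = u is trivial. *)
Lemma derivable_on_continuous (R : realType) (I : interval R) (f : R -> R)
    (A : set R) : A `<=` [set` I] ->
  (forall u, A u -> derivable_on I f u) -> {within A, continuous f}.
Proof.
move=> AI df; apply/subspace_continuousP => u Au.
have := df _ Au; rewrite /derivable_on.
set l := lim _ => /= cu.
have c1 : (f u + diff_quotient f u y * (y - u)) @[y --> within [set` I] u^']
    --> f u + l * (u - u).
  apply: cvgD; first exact: cvg_cst.
  apply: cvgM; first exact: cu.
  apply: cvgB; last exact: cvg_cst.
  apply: cvg_within_filter; apply: cvg_within.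
rewrite subrr mulr0 addr0 in c1.
apply/cvgrPdist_lt => e e0; move/cvgrPdist_lt : c1 => /(_ _ e0) c1.
have {}c1 : \forall y \near u, y != u -> [set` I] y ->
    `|f u - (f u + diff_quotient f u y * (y - u))| < e by exact: c1.
suff : \forall y \near u, A y -> `|f u - f y| < e by [].
apply: filterS c1 => y + Ay.
have [->|yu] := eqVneq y u; first by move=> _; rewrite subrr normr0.
move=> /(_ isT (AI _ Ay)); rewrite /diff_quotient divfK ?subr_eq0//.
by rewrite [X in f u - X]addrC subrK.
Qed.

(** This is the estimate for one half, the weight s - u vanishing at the left end. The bound is the
    increment of a primitive of the majorant given by [normalized_young] with d = s - u. *)
Lemma weighted_increment_le (R : realType) (p q c m : R) (g w : R -> R)
    (u v : R) :
  0 < p -> 0 < q -> p^-1 + q^-1 = 1 -> 0 < c -> u <= v ->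
  {within `[u, v], continuous g} ->
  (forall s, s \in `]u, v[ -> is_derive s 1 g ((s - u) * w s)) ->
  (forall s, s \in `]u, v[ -> `|w s| `^ q <= m - c * ((s - u) * (v - s))) ->
  `|g v - g u| <= (v - u) ^+ 2 * (1 / (p + 1)) `^ (1 / p)
                  * (m - c * (v - u) ^+ 2 / 6) `^ (1 / q).
Proof.
move=> p0 q0 pq c0; rewrite le_eqVlt => /predU1P[->|uv] cg dg wle.
  by rewrite !subrr normr0 expr0n /= !mul0r.
(* K is the mean over [u, v] of m - c (s - u)(v - s), as (s - u)(v - s) has integral A^3 / 6. *)
pose A := v - u; pose K := m - c * A ^+ 2 / 6.
have A0 : 0 < A by rewrite subr_gt0.
have K0 : 0 < K.
  (* At the midpoint the hypothesis gives m >= c A^2 / 4, which exceeds c A^2 / 6. *)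
  have := wle ((u + v) / 2); rewrite in_itv/= !midf_lt// => /(_ isT).
  move=> /(le_trans (powR_ge0 _ _)).
  have -> : ((u + v) / 2 - u) * (v - (u + v) / 2) = A ^+ 2 / 4.
    by rewrite /A; field.
  by have := mulr_gt0 c0 (exprn_gt0 2 A0); rewrite /K; lra.
rewrite -/A -/K.
pose C := A * (1 / (p + 1)) `^ (1 / p) * K `^ (1 / q).
(* The norm makes N continuous at u: `^ is constantly 1 on negative bases. *)
pose N t := `|(t - u) / A| `^ (p + 1).
(* P is the primitive of m - c (t - u)(v - t) vanishing at u, from (t - u)(v - t) = A (t - u) - (t -
   u)^2. *)
pose P t := m * (t - u) - c * (A / 2 * (t - u) ^+ 2 - 1 / 3 * (t - u) ^+ 3).
pose H t := C * (A / p * N t + (K * q)^-1 * P t).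
pose h t := C * ((p + 1) / p * ((t - u) / A) `^ p
  + (m - c * ((t - u) * (v - t))) / (K * q)).
have p10 : 0 < p + 1 by lra.
(* Since N v = 1 and P v = A K, the two terms contribute C A / p and C A / q, which add up to C
   A. *)
have Huv : H v - H u = A ^+ 2 * (1 / (p + 1)) `^ (1 / p) * K `^ (1 / q).
  rewrite /H /N /P -/A !subrr divff ?gt_eqF// mul0r normr0 normr1 powR1.
  rewrite powR0 ?gt_eqF//.
  transitivity (C * A * (p^-1 + q^-1)); last by rewrite pq /C; ring.
  have K6 : m * 6 - c * A ^+ 2 != 0.
    by rewrite gt_eqF//; move: K0; rewrite /K; lra.
  by rewrite /K; field; rewrite K6 !gt_eqF.
have dlin (t : R) : is_derive t 1 (fun t => t - u) 1 by exact: is_derive_shift.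
have dexp2 (t : R) : is_derive t 1 (fun t => (t - u) ^+ 2) (2 * (t - u)).
  apply: (is_derive_eq (@is_deriveX R R (fun t => t - u) 2 t 1 1 (dlin t))).
  by rewrite [LHS]mulr1.
have dexp3 (t : R) : is_derive t 1 (fun t => (t - u) ^+ 3) (3 * (t - u) ^+ 2).
  apply: (is_derive_eq (@is_deriveX R R (fun t => t - u) 3 t 1 1 (dlin t))).
  by rewrite [LHS]mulr1.
have dP (t : R) : is_derive t 1 P (m - c * ((t - u) * (v - t))).
  have d23 := @is_deriveB R R R _ _ t 1 _ _
    (@is_deriveZ R R R _ (A / 2) t 1 _ (dexp2 t))
    (@is_deriveZ R R R _ (1 / 3) t 1 _ (dexp3 t)).
  have dd := @is_deriveB R R R _ _ t 1 _ _
    (@is_deriveZ R R R _ m t 1 _ (dlin t)) (@is_deriveZ R R R _ c t 1 _ d23).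
  by apply: (is_derive_eq dd); rewrite /GRing.scale/= /A; field.
rewrite -Huv; apply: (@increment_le R g H (fun s => (s - u) * w s) h).
- exact: ltW.
- move=> s; rewrite in_itv/= => /andP[us sv].
  have su : 0 < (s - u) / A by rewrite divr_gt0 ?subr_gt0.
  have dN : is_derive s 1 N (A^-1 * ((p + 1) * ((s - u) / A) `^ p)).
    have dl : is_derive s 1 (fun t => A^-1 * (t - u)) (A^-1 * 1).
      exact: (@is_deriveZ R R R _ A^-1 s 1 1 (dlin s)).
    have := is_derive_normr_powR (p + 1) su; rewrite [(s - u) / A]mulrC => dn.
    have -> : N = (fun t => `|t| `^ (p + 1)) \o (fun t => A^-1 * (t - u)).
      by apply/funext => t; rewrite /N /= mulrC.
    apply: (is_derive_eq (@is_derive1_comp R (fun t => `|t| `^ (p + 1))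
      (fun t => A^-1 * (t - u)) s _ _ dn dl)).
    by rewrite addrK [A^-1 * (s - u)]mulrC; ring.
  have dd := @is_deriveD R R R _ _ s 1 _ _
    (@is_deriveZ R R R _ (A / p) s 1 _ dN)
    (@is_deriveZ R R R _ (K * q)^-1 s 1 _ (dP s)).
  apply: (is_derive_eq (@is_deriveZ R R R _ C s 1 _ dd)).
  rewrite /h /GRing.scale/= /A; field.
  by rewrite !gt_eqF// -/A.
- exact: cg.
- apply: continuous_subspaceT => t.
  have cN : {for t, continuous N}.
    have cl : (s - u) / A @[s --> t] --> (t - u) / A.
      apply: cvgM; last exact: cvg_cst.
      by apply: cvgB; [exact: cvg_id|exact: cvg_cst].
    exact: (cvg_comp _ _ cl (@continuous_normr_powR R (p + 1) p10 _)).
  have cP : {for t, continuous P}.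
    apply: differentiable_continuous; apply/derivable1_diffP.
    by have := dP t; case.
  apply: cvgM; first exact: cvg_cst.
  by apply: cvgD; apply: cvgM => //; exact: cvg_cst.
- move=> s sI; have := wle _ sI; move: sI; rewrite in_itv/= => /andP[us sv] ws.
  have su : 0 <= s - u by rewrite subr_ge0 ltW.
  rewrite normrM (ger0_norm su).
  apply: (le_trans (normalized_young p0 q0 pq A0 K0 su (normr_ge0 _))).
  rewrite ler_wpM2l ?mulr_ge0 ?powR_ge0 ?(ltW A0)//.
  by rewrite lerD2l ler_pM2r// invr_gt0 mulr_gt0.
Qed.

Theorem theorem2 (R : realType) (I : interval R) (a b : R) (f : R -> R)
    (p q c M x : R) :
  a \in I -> b \in I -> a < b ->
  (forall u, ([set` I]° : set R) u -> derivable f u 1) ->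
  (forall u, u \in `[a, b] -> derivable_on I f u) ->
  (@lebesgue_measure R).-integrable `[a, b] (EFin \o derive1_on I f) ->
  1 < q -> 1 / p + 1 / q = 1 ->
  0 < c ->
  strongly_convex `[a, b] c (fun u => `|derive1_on I f u| `^ q) ->
  (forall u, u \in `[a, b] -> `|derive1_on I f u| <= M) ->
  x \in `[a, b] ->
  Num.max (c * (x - a) ^+ 2 / 6) (c * (b - x) ^+ 2 / 6) <= M `^ q ->
  `|f x - 1 / (b - a) * \int[@lebesgue_measure R]_(u in `[a, b]) f u|
  <= (x - a) ^+ 2 / (b - a) * (1 / (p + 1)) `^ (1 / p)
       * (M `^ q - c * (x - a) ^+ 2 / 6) `^ (1 / q)
     + (b - x) ^+ 2 / (b - a) * (1 / (p + 1)) `^ (1 / p)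
       * (M `^ q - c * (b - x) ^+ 2 / 6) `^ (1 / q).
Proof.
move=> aI bI ab df dfab _ q1 pq c0 scf fM xab _.
have q0 : 0 < q by lra.
have p0 : 0 < p.
  rewrite -invr_gt0 -div1r; suff : 1 / q < 1 by move: pq; lra.
  by rewrite div1r invf_lt1.
rewrite 2!div1r in pq.
have abI : `[a, b] `<=` [set` I].
  by move=> u /=; rewrite in_itv/= => aub; exact: (interval_is_interval aI bI).
have abo s : s \in `]a, b[ -> ([set` I]° : set R) s.
  move=> sab; apply: filterS (near_in_itvoo sab) => z zab; apply: abI.
  exact: subset_itv_oo_cc zab.
have cf : {within `[a, b], continuous f}.
  exact: derivable_on_continuous abI dfab.
have intf : (@lebesgue_measure R).-integrable `[a, b] (EFin \o f).
  by apply: continuous_compact_integrable => //; exact: segment_compact.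
(* F u is the integral of f from a to u; continuity of f makes it a primitive on the open
   interval. *)
pose F := (@parameterized_integral R lebesgue_measure a)^~ f.
have cF : {within `[a, b], continuous F}.
  exact: parameterized_integral_continuous (ltW ab) intf.
have dF s : s \in `]a, b[ -> is_derive s 1 F (f s).
  move=> sab; have cfs := within_continuous_continuous ab cf sab.
  move: (sab); rewrite in_itv/= => /andP[as_ sb].
  have [D1 D2] := continuous_FTC1_closed sb intf as_ cfs.
  by rewrite derive1E in D2; exact: DeriveDef D1 D2.
have dfs s : s \in `]a, b[ -> is_derive s 1 f (derive1_on I f s).
  move=> sab; rewrite derive1_onE; last exact: abo.
  by rewrite derive1E; apply: derivableP; apply: df; exact: abo.
pose G e u := (u - e) * f u - F u.
have cG e : {within `[a, b], continuous (G e)}.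
  have cl : {within `[a, b], continuous (fun u : R => u - e)}.
    apply: continuous_subspaceT => z.
    by apply: cvgB; [exact: cvg_id|exact: cvg_cst].
  apply: (@within_continuousB _ _ _ _ (fun u => (u - e) * f u) F) => // z.
  exact: cvgM (cl z) (cf z).
have dG e s : s \in `]a, b[ -> is_derive s 1 (G e) ((s - e) * derive1_on I f s).
  move=> sab.
  have := @is_deriveB R R R (fun u => (u - e) * f u) F s 1 _ _ _ (dF s sab).
  have dl : is_derive s 1 (fun u : R => u - e) 1 by exact: is_derive_shift.
  have := @is_deriveM R R _ f s 1 _ _ dl (dfs s sab) => dm /(_ _ dm) dg.
  by apply: (is_derive_eq dg); rewrite /GRing.scale/=; ring.
have M0 : 0 <= M by exact: le_trans (normr_ge0 _) (fM _ xab).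
(* M^q dominates |f'|^q at both ends of any subinterval, so the strong convexity gap is measured
   from y and z rather than from a and b. *)
have bnd y z s : y \in `[a, b] -> z \in `[a, b] -> s \in `]y, z[ ->
    `|derive1_on I f s| `^ q <= M `^ q - c * ((s - y) * (z - s)).
  move=> yab zab; apply: (strongly_convex_le scf) => //.
    by apply: ge0_ler_powR; rewrite ?nnegrE ?(ltW q0) ?fM ?M0.
  by apply: ge0_ler_powR; rewrite ?nnegrE ?(ltW q0) ?fM ?M0.
move: (xab); rewrite in_itv/= => /andP[ax xb].
have aab : a \in `[a, b] by rewrite in_itv/= lexx ltW.
have bab : b \in `[a, b] by rewrite in_itv/= lexx ltW.
have cL : {within `[a, x], continuous (G a)}.
  by apply: continuous_subspaceW (cG a); exact: subset_itvl.
have dL s : s \in `]a, x[ -> is_derive s 1 (G a) ((s - a) * derive1_on I f s).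
  by move=> sI; apply: dG; apply: subset_itvl sI; exact: xb.
have L := @weighted_increment_le R p q c (M `^ q) (G a) (derive1_on I f) a x
  p0 q0 pq c0 ax cL dL (fun s => bnd a x s aab xab).
(* The weight u - b vanishes at the right end of [x, b]. Reflecting by u -> -u moves this zero to
   the left end -b, and the two sign changes in the derivative cancel. *)
have cR : {within `[- b, - x], continuous (G b \o -%R)}.
  apply: within_continuous_compN; rewrite !opprK.
  by apply: continuous_subspaceW (cG b); exact: subset_itvr.
have dR s : s \in `]- b, - x[ ->
    is_derive s 1 (G b \o -%R) ((s - - b) * derive1_on I f (- s)).
  move=> sI.
  have dGs : is_derive (- s) 1 (G b) ((- s - b) * derive1_on I f (- s)).
    apply: dG; move: sI; rewrite !in_itv/= => /andP[bs sx].
    by apply/andP; split; lra.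
  have dN : is_derive s 1 (-%R : R -> R) (-1) by exact: is_deriveN.
  apply: (is_derive_eq (is_derive1_comp dGs dN)).
  by rewrite opprK; ring.
have wR s : s \in `]- b, - x[ -> `|derive1_on I f (- s)| `^ q <=
    M `^ q - c * ((s - - b) * (- x - s)).
  move=> sI.
  have -> : (s - - b) * (- x - s) = ((- s) - x) * (b - (- s)) by ring.
  by apply: bnd => //; rewrite oppr_itvoo.
have bx : - b <= - x by rewrite lerN2.
have Rt := @weighted_increment_le R p q c (M `^ q) (G b \o -%R)
  (fun s => derive1_on I f (- s)) (- b) (- x) p0 q0 pq c0 bx cR dR wR.
rewrite /= !opprK [- x + b]addrC in Rt.
have Fa : F a = 0.
  by rewrite /F /parameterized_integral set_itv1 Rintegral_set1.
have ba : b - a != 0 by rewrite subr_eq0 gt_eqF.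
(* Here G a x - G b x = (b - a) f x, while G a a = 0 and G b b = - F b. *)
have -> : f x - 1 / (b - a) * \int[@lebesgue_measure R]_(u in `[a, b]) f u =
    ((G a x - G a a) - (G b x - G b b)) / (b - a).
  by rewrite /G Fa -[Rintegral _ _ _]/(F b); field.
rewrite normrM normfV (gtr0_norm (_ : 0 < b - a)) ?subr_gt0//.
rewrite ler_pdivrMr ?subr_gt0//.
apply: (le_trans (ler_normB _ _)); apply: (le_trans (lerD L Rt)).
by rewrite le_eqVlt; apply/orP; left; apply/eqP; field.
Qed.
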